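(* Let $(A,\circ,B(\cdot,\cdot))$ be a quadratic Novikov algebra over $\mathbf{k}$. Then the adjoint representation $(A,L_{\circ},R_{\circ})$ of $(A,\circ)$ is isomorphic, as a representation of $(A,\circ)$, to the representation $(A^{\ast},L^{\ast}_{\star},-R^{\ast}_{\circ})$.
   Context: $\mathbf{k}$ is a field of characteristic zero; all vector spaces and algebras are finite-dimensional over $\mathbf{k}$. A Novikov algebra $(A,\circ)$ is a vector space with a bilinear operation $\circ$ such that $(a\circ b)\circ c-a\circ(b\circ c)=(b\circ a)\circ c-b\circ(a\circ c)$ and $(a\circ b)\circ c=(a\circ c)\circ b$ for all $a,b,c\in A$. Put $a\star b:=a\circ b+b\circ a$. A quadratic Novikov algebra $(A,\circ,B(\cdot,\cdot))$ is a Novikov algebra with a nondegenerate symmetric bilinear form $B:A\times A\to\mathbf{k}$ such that $B(a\circ b,c)=-B(b,a\star c)$ for all $a,b,c\in A$. A representation of $(A,\circ)$ is a triple $(V,l,r)$ with $V$ a vector space and $l,r:A\to\mathrm{End}_{\mathbf{k}}(V)$ linear maps such that, for all $a,b\in A$, $v\in V$: $l(a\circ b-b\circ a)v=l(a)l(b)v-l(b)l(a)v$; $l(a)r(b)v-r(b)l(a)v=r(a\circ b)v-r(a)r(b)v$; $l(a\circ b)v=r(b)l(a)v$; $r(a)r(b)v=r(b)r(a)v$. An isomorphism of representations $(V_1,l_1,r_1)\to(V_2,l_2,r_2)$ is a linear bijection $\varphi:V_1\to V_2$ with $\varphi(l_1(a)v)=l_2(a)\varphi(v)$ and $\varphi(r_1(a)v)=r_2(a)\varphi(v)$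 for all $a\in A$, $v\in V_1$. Notation: $L_\circ(a)b=a\circ b$, $R_\circ(a)b=b\circ a$, $L_\star(a)b=a\star b$. For linear $\varphi:A\to\mathrm{End}_{\mathbf{k}}(V)$, the map $\varphi^\ast:A\to\mathrm{End}_{\mathbf{k}}(V^\ast)$ is given by $\langle\varphi^\ast(a)f,v\rangle=-\langle f,\varphi(a)v\rangle$. The triples $(A,L_\circ,R_\circ)$ (the adjoint representation) and $(A^\ast,L_\star^\ast,-R_\circ^\ast)$ are known to be representations of $(A,\circ)$. *)

(* Defs.v *)
From HB Require Import structures.
From mathcomp Require Import all_boot all_order all_algebra ring.

Set Implicit Arguments.
Unset Strict Implicit.
Unset Printing Implicit Defensive.

Import GRing.Theory.
Local Open Scope ring_scope.

Record novikov (k : fieldType) := Novikov {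
  nov_sort :> vectType k;
  nov_mul : {bilinear nov_sort -> nov_sort -> nov_sort};
  nov_left_symmetric : forall a b c : nov_sort,
    nov_mul (nov_mul a b) c - nov_mul a (nov_mul b c) =
    nov_mul (nov_mul b a) c - nov_mul b (nov_mul a c);
  nov_right_commutative : forall a b c : nov_sort,
    nov_mul (nov_mul a b) c = nov_mul (nov_mul a c) b
}.

Arguments nov_mul {k} A : rename.

Notation "a \circ b" := (nov_mul _ a b)
  (at level 40, left associativity, format "a  \circ  b") : ring_scope.

Definition nov_star (k : fieldType) (A : novikov k) (a b : A) : A :=
  a \circ b + b \circ a.

Notation "a \star b" := (nov_star a b)
  (at level 40, left associativity, format "a  \star  b") : ring_scope.

Record quadratic_novikov (k : fieldType) := QuadraticNovikov {
  qnov_novikov :> novikov k;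
  qnov_form : {symmetric qnov_novikov};
  qnov_nondegenerate : nondegenerate qnov_form;
  qnov_invariant : forall a b c : qnov_novikov,
    qnov_form (a \circ b) c = - qnov_form b (a \star c)
}.

Record nov_rep (k : fieldType) (A : novikov k) := NovRep {
  rep_sort :> vectType k;
  rep_l : {linear A -> 'End(rep_sort)};
  rep_r : {linear A -> 'End(rep_sort)};
  rep_lie : forall (a b : A) (v : rep_sort),
    rep_l (a \circ b - b \circ a) v =
    rep_l a (rep_l b v) - rep_l b (rep_l a v);
  rep_lr : forall (a b : A) (v : rep_sort),
    rep_l a (rep_r b v) - rep_r b (rep_l a v) =
    rep_r (a \circ b) v - rep_r a (rep_r b v);
  rep_rl : forall (a b : A) (v : rep_sort),
    rep_l (a \circ b) v = rep_r b (rep_l a v);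
  rep_rr : forall (a b : A) (v : rep_sort),
    rep_r a (rep_r b v) = rep_r b (rep_r a v)
}.

Definition nov_rep_isomorphic (k : fieldType) (A : novikov k)
    (V1 V2 : nov_rep A) : Prop :=
  exists phi : {linear V1 -> V2},
    [/\ bijective phi,
        forall (a : A) (v : V1), phi (rep_l V1 a v) = rep_l V2 a (phi v) &
        forall (a : A) (v : V1), phi (rep_r V1 a v) = rep_r V2 a (phi v)].

Section Multiplications.
Variables (k : fieldType) (A : novikov k).
Implicit Types a b c : A.

(* linfun f agrees with f because f is linear: see Lcirc_E, Rcirc_E, Lstar_E. *)
Definition Lcirc a : 'End(A) := linfun (fun b => a \circ b).
Definition Rcirc a : 'End(A) := linfun (fun b => b \circ a).
Definition Lstar a : 'End(A) := linfun (fun b => a \star b).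

Lemma Lcirc_E a b : Lcirc a b = a \circ b.
Proof. exact: (lfunE (nov_mul A a)). Qed.

Lemma Rcirc_E a b : Rcirc a b = b \circ a.
Proof. exact: (lfunE (applyr (nov_mul A) a)). Qed.

Fact Lstar_subproof a : linear (fun b => a \star b).
Proof.
by move=> x b c; rewrite /nov_star linearPr linearPl scalerDr addrACA.
Qed.

Lemma Lstar_E a b : Lstar a b = a \star b.
Proof.
pose f := GRing.isLinear.Build k A A _ _ (Lstar_subproof a).
pose F : {linear A -> A} := HB.pack (fun b => a \star b) f.
exact: (lfunE F).
Qed.

Fact Lcirc_linear : linear Lcirc.
Proof.
by move=> x a b; apply/lfunP=> c; rewrite !lfunE /= lfunE /= !Lcirc_E linearPl.
Qed.
Fact Rcirc_linear : linear Rcirc.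
Proof.
by move=> x a b; apply/lfunP=> c; rewrite !lfunE /= lfunE /= !Rcirc_E linearPr.
Qed.
Fact Lstar_linear : linear Lstar.
Proof.
move=> x a b; apply/lfunP=> c; rewrite !lfunE /= lfunE /= !Lstar_E /nov_star.
by rewrite linearPr linearPl scalerDr addrACA.
Qed.
HB.instance Definition _ := GRing.isLinear.Build k A 'End(A) _ Lcirc Lcirc_linear.
HB.instance Definition _ := GRing.isLinear.Build k A 'End(A) _ Rcirc Rcirc_linear.
HB.instance Definition _ := GRing.isLinear.Build k A 'End(A) _ Lstar Lstar_linear.
End Multiplications.

Definition dual (k : fieldType) (V : vectType k) : vectType k := 'Hom(V, k^o).

Section DualMap.
Variables (k : fieldType) (A V : vectType k) (phi : {linear A -> 'End(V)}).

(* The contragredient phi^*, with the sign of dual_mapE below; linfun is again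
   applied to a linear function. *)
Definition dual_map (a : A) : 'End(dual V) :=
  linfun (fun f : 'Hom(V, k^o) => - (f \o phi a)%VF).

Fact dual_map_subproof a :
  linear (fun f : 'Hom(V, k^o) => - (f \o phi a)%VF).
Proof.
move=> x f g; apply/lfunP=> v.
rewrite !(opp_lfunE, comp_lfunE, add_lfunE, scale_lfunE).
by rewrite opprD scalerN.
Qed.

Lemma dual_mapE a (f : 'Hom(V, k^o)) v :
  (dual_map a f : 'Hom(V, k^o)) v = - f (phi a v).
Proof.
pose m := GRing.isLinear.Build k 'Hom(V, k^o) 'Hom(V, k^o) _ _ (dual_map_subproof a).
pose F : {linear 'Hom(V, k^o) -> 'Hom(V, k^o)} :=
  HB.pack (fun f : 'Hom(V, k^o) => - (f \o phi a)%VF) m.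
by rewrite /dual_map (lfunE F) /= opp_lfunE comp_lfunE.
Qed.

Fact dual_map_linear : linear dual_map.
Proof.
move=> x a b; apply/lfunP=> f; apply/lfunP=> v.
rewrite add_lfunE scale_lfunE dual_mapE add_lfunE scale_lfunE !dual_mapE.
by rewrite linearP add_lfunE scale_lfunE linearP opprD scalerN.
Qed.
HB.instance Definition _ :=
  GRing.isLinear.Build k A 'End(dual V) _ dual_map dual_map_linear.
End DualMap.

Section Representations.
Variables (k : fieldType) (A : novikov k).

Definition nov_dual_l : {linear A -> 'End(dual A)} := dual_map (@Lstar k A).
Definition nov_dual_r : {linear A -> 'End(dual A)} := \- dual_map (@Rcirc k A).

Lemma nov_dual_lE a (f : 'Hom(A, k^o)) b :
  (nov_dual_l a f : 'Hom(A, k^o)) b = - f (a \star b).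
Proof. by rewrite dual_mapE Lstar_E. Qed.

Lemma nov_dual_rE a (f : 'Hom(A, k^o)) b :
  (nov_dual_r a f : 'Hom(A, k^o)) b = f (b \circ a).
Proof. by rewrite /= opp_lfunE opp_lfunE dual_mapE Rcirc_E opprK. Qed.
Fact nov_adjoint_lie a b (v : A) :
  Lcirc (a \circ b - b \circ a) v =
  Lcirc a (Lcirc b v) - Lcirc b (Lcirc a v).
Proof.
rewrite !Lcirc_E linearBl; have /eqP := nov_left_symmetric a b v.
rewrite subr_eq => /eqP ->.
by rewrite addrAC [X in X + _]addrAC subrr add0r addrC.
Qed.

Fact nov_adjoint_lr a b (v : A) :
  Lcirc a (Rcirc b v) - Rcirc b (Lcirc a v) =
  Rcirc (a \circ b) v - Rcirc a (Rcirc b v).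
Proof.
rewrite !(Lcirc_E, Rcirc_E) -opprB nov_left_symmetric opprB.
by rewrite (nov_right_commutative v a).
Qed.

Fact nov_adjoint_rl a b (v : A) :
  Lcirc (a \circ b) v = Rcirc b (Lcirc a v).
Proof. by rewrite !(Lcirc_E, Rcirc_E) nov_right_commutative. Qed.

Fact nov_adjoint_rr a b (v : A) :
  Rcirc a (Rcirc b v) = Rcirc b (Rcirc a v).
Proof. by rewrite !Rcirc_E nov_right_commutative. Qed.

Definition nov_adjoint : nov_rep A :=
  NovRep nov_adjoint_lie nov_adjoint_lr nov_adjoint_rl nov_adjoint_rr.

Let mulDl (a b c : A) : (a + b) \circ c = a \circ c + b \circ c.
Proof. exact: linearDl. Qed.
Let mulDr (a b c : A) : a \circ (b + c) = a \circ b + a \circ c.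
Proof. exact: linearDr. Qed.
Let mulBl (a b c : A) : (a - b) \circ c = a \circ c - b \circ c.
Proof. exact: linearBl. Qed.
Let mulBr (a b c : A) : a \circ (b - c) = a \circ b - a \circ c.
Proof. exact: linearBr. Qed.

Let formD (f : 'Hom(A, k^o)) x y : f (x + y) = f x + f y :> k.
Proof. exact: (linearD f x y). Qed.
Let formN (f : 'Hom(A, k^o)) x : f (- x) = - f x :> k.
Proof. exact: (linearN f x). Qed.

Let homBE (f g : 'Hom(A, k^o)) x : (f - g) x = f x - g x :> k.
Proof. by rewrite add_lfunE opp_lfunE. Qed.

(* Left symmetry under a functional f, solved for f (a \circ (b \circ c)); the
   codomain is k, where the ring tactic is available. *)
Let left_symmetric_under (f : 'Hom(A, k^o)) a b c :
  f (a \circ (b \circ c)) =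
  f (a \circ b \circ c) - f (b \circ a \circ c) + f (b \circ (a \circ c)) :> k.
Proof.
have := congr1 f (nov_left_symmetric a b c); rewrite !linearB /= => e.
by rewrite -[LHS](subKr (f (a \circ b \circ c))) [X in _ - X]e; ring.
Qed.

Fact nov_dual_lie a b (f : dual A) :
  nov_dual_l (a \circ b - b \circ a) f =
  nov_dual_l a (nov_dual_l b f) - nov_dual_l b (nov_dual_l a f).
Proof.
apply/lfunP=> c; rewrite homBE (nov_dual_lE (a \circ b - b \circ a) f c).
rewrite (nov_dual_lE a (nov_dual_l b f) c) (nov_dual_lE b f (a \star c)).
rewrite (nov_dual_lE b (nov_dual_l a f) c) (nov_dual_lE a f (b \star c)).
rewrite /nov_star mulBl mulBr !mulDl !mulDr !(formD, formN).
rewrite (left_symmetric_under f a c b) (left_symmetric_under f b c a).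
rewrite (left_symmetric_under f a b c).
rewrite (nov_right_commutative c b a) (nov_right_commutative b a c).
rewrite (nov_right_commutative a c b).
ring.
Qed.

Fact nov_dual_lr a b (f : dual A) :
  nov_dual_l a (nov_dual_r b f) - nov_dual_r b (nov_dual_l a f) =
  nov_dual_r (a \circ b) f - nov_dual_r a (nov_dual_r b f).
Proof.
apply/lfunP=> c; rewrite !homBE.
rewrite (nov_dual_lE a (nov_dual_r b f) c) (nov_dual_rE b f (a \star c)).
rewrite (nov_dual_rE b (nov_dual_l a f) c) (nov_dual_lE a f (c \circ b)).
rewrite (nov_dual_rE (a \circ b) f c) (nov_dual_rE a (nov_dual_r b f) c).
rewrite (nov_dual_rE b f (c \circ a)) /nov_star mulDl !formD.
rewrite (left_symmetric_under f a c b) (nov_right_commutative c b a).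
ring.
Qed.

Fact nov_dual_rl a b (f : dual A) :
  nov_dual_l (a \circ b) f = nov_dual_r b (nov_dual_l a f).
Proof.
apply/lfunP=> c; rewrite (nov_dual_lE (a \circ b) f c).
rewrite (nov_dual_rE b (nov_dual_l a f) c) (nov_dual_lE a f (c \circ b)).
rewrite /nov_star !formD.
rewrite (left_symmetric_under f a c b) (nov_right_commutative c b a).
rewrite (nov_right_commutative a b c).
ring.
Qed.

Fact nov_dual_rr a b (f : dual A) :
  nov_dual_r a (nov_dual_r b f) = nov_dual_r b (nov_dual_r a f).
Proof.
apply/lfunP=> c; rewrite (nov_dual_rE a (nov_dual_r b f) c).
rewrite (nov_dual_rE b (nov_dual_r a f) c) (nov_dual_rE b f (c \circ a)).
by rewrite (nov_dual_rE a f (c \circ b)) nov_right_commutative.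
Qed.

(* Left action: dual of Lstar; right action: minus the dual of Rcirc. *)
Definition nov_coadjoint : nov_rep A :=
  NovRep nov_dual_lie nov_dual_lr nov_dual_rl nov_dual_rr.
End Representations.

(* Main.v *)
(** The isomorphism is [v |-> B(v, _)]. It is injective because [B] is
    nondegenerate, hence bijective by comparing dimensions. It intertwines the
    left actions by invariance of [B], and the right actions because
    [B(v \circ a, c) = - B(a, v \star c) = - B(a, c \star v) = B(c \circ a, v)]. *)
From HB Require Import structures.
Require Import Defs.
From mathcomp Require Import all_boot all_order all_algebra.
Local Open Scope ring_scope.
Import GRing.Theory.

Lemma linear_inj_bij (k : fieldType) (U V : vectType k) (f : {linear U -> V}) :
  dim U = dim V -> injective f -> bijective f.
Proof.
move=> dimUV f_inj.
have kerf : lker (linfun f) == 0%VS.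
  by apply/lker0P => x y; rewrite !lfunE; apply: f_inj.
have imf : limg (linfun f) = fullv.
  apply/eqP; rewrite eqEdim subvf limg_dim_eq ?(eqP kerf) ?capv0 //.
  by rewrite !dimvf dimUV leqnn.
exists (linfun f)^-1%VF => x; first by rewrite -[f x]lfunE lker0_lfunK.
by rewrite -[f _]lfunE limg_lfunVK // imf memvf.
Qed.

(** The dimension of a Hom space computes to the product of the two dimensions, here [dim V * 1]
    since [k^o] is a line. *)
Lemma dim_dual (k : fieldType) (V : vectType k) : dim (dual V) = dim V.
Proof. exact: muln1. Qed.

Section FormDual.
Context {k : fieldType} {V : vectType k}.
Variable B : {symmetric V}.

Definition form_dual (v : V) : dual V := linfun (B v : V -> k^o).

Lemma form_dualE u v : (form_dual u : 'Hom(V, k^o)) v = B u v.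
Proof. exact: lfunE. Qed.

Fact form_dual_linear : linear form_dual.
Proof.
move=> x u v; apply/lfunP => w.
by rewrite add_lfunE scale_lfunE !form_dualE linearPl.
Qed.

HB.instance Definition _ :=
  GRing.isLinear.Build k V (dual V) _ form_dual form_dual_linear.

Lemma symmetric_formC u v : B u v = B v u.
(* [B] is a Hermitian form with sign [(-1) ^+ false] and the identity as twist. *)
Proof. by rewrite hermC expr0 mul1r. Qed.

Lemma form_dual_inj : nondegenerate B -> injective form_dual.
Proof.
move=> /eqP radB; apply: raddf_inj => u Bu0.
(* [u] is orthogonal to every vector, so it lies in the radical of [B], which is zero. *)
apply/eqP; rewrite -memv0 -radB; apply/mem_orthovP => v _.
by rewrite -form_dualE Bu0 lfunE.
Qed.

Lemma form_dual_bij : nondegenerate B -> bijective form_dual.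
Proof. by move=> /form_dual_inj; apply/linear_inj_bij/esym/dim_dual. Qed.

End FormDual.

Lemma nov_starC (k : fieldType) (A : novikov k) (a b : A) : a \star b = b \star a.
Proof. exact: addrC. Qed.

(** Right multiplications are self-adjoint for [B]: [\star] is commutative, so invariance applies
    once in each direction and the signs cancel. As [nov_dual_r] is the plain transpose of [Rcirc],
    this is what intertwines the right actions. *)
Lemma qnov_form_Rcirc (k : fieldType) (A : quadratic_novikov k) (a b c : A) :
  qnov_form A (a \circ b) c = qnov_form A a (c \circ b).
Proof.
by rewrite qnov_invariant nov_starC -qnov_invariant symmetric_formC.
Qed.

Theorem proposition2p8 (k : fieldType) (k_char0 : [pchar k] =i pred0)
    (A : quadratic_novikov k) :
  nov_rep_isomorphic (nov_adjoint A) (nov_coadjoint A).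
Proof.
exists (form_dual (qnov_form A)).
split=> [|a v|a v]; first exact/form_dual_bij/qnov_nondegenerate.
  apply/lfunP => c; rewrite form_dualE [LHS]/= Lcirc_E qnov_invariant.
  by rewrite nov_dual_lE form_dualE.
apply/lfunP => c; rewrite form_dualE [LHS]/= Rcirc_E qnov_form_Rcirc.
by rewrite nov_dual_rE form_dualE.
Qed.
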